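(* Let $(u_n)_{n=0}^{\infty}$ be a sequence of real numbers. Then $(u_n)_{n=0}^{\infty}$ is convex if and only if for all $n_1,n_2\in\mathbb{N}\cup\{0\}$ with $n_1\equiv n_2 \pmod 2$ one has $$\left(\frac{n_1+n_2}{2},\ \frac{u_{n_1}+u_{n_2}}{2}\right)\in \mathrm{epi}(u_n).$$
   Context: $\mathbb{N}$ denotes the set of positive integers. A real sequence $(u_n)_{n=0}^{\infty}$ is called convex if $2u_n\le u_{n-1}+u_{n+1}$ for all $n\in\mathbb{N}$. The epigraph of a real sequence $(u_n)_{n=0}^{\infty}$ is the set $\mathrm{epi}(u_n):=\{(n,y) : n\in\mathbb{N}\cup\{0\},\ u_n\le y\}\subseteq(\mathbb{N}\cup\{0\})\times\mathbb{R}$. *)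

(* Defs.v *)
From mathcomp Require Import all_boot all_order all_algebra.
From mathcomp Require Import classical_sets reals.

Set Implicit Arguments.
Unset Strict Implicit.
Unset Printing Implicit Defensive.

Import Order.TTheory GRing.Theory Num.Theory.
Local Open Scope ring_scope.
Local Open Scope classical_set_scope.

Definition convex_seq (R : realType) (u : nat -> R) : Prop :=
  forall n : nat, (0 < n)%N -> 2 * u n <= u n.-1 + u n.+1.

Definition epi (R : realType) (u : nat -> R) : set (nat * R) :=
  [set p | u p.1 <= p.2].

(* Main.v *)
Require Import Defs.
From mathcomp Require Import all_boot all_order all_algebra.
From mathcomp Require Import classical_sets reals.
From mathcomp Require Import zify lra.

(** Convexity says that the increments [u n.+1 - u n] are nondecreasing.  For
    two indices of equal parity, write them as [m] and [m + 2k], with midpoint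
    [m + k].  Moving both indices one step towards the midpoint changes
    [u m + u (m + 2k)] by the increment at the left end minus the increment at
    the right end, hence does not increase it ([increments_nondecreasing]);
    after [k] such moves both indices sit at the midpoint
    ([convex_seq_midpoint]).  Conversely, convexity at [n] is the midpoint
    inequality for the indices [n - 1] and [n + 1]. *)

Set Implicit Arguments.
Unset Strict Implicit.
Unset Printing Implicit Defensive.

Import Order.TTheory GRing.Theory Num.Theory.
Local Open Scope ring_scope.
Local Open Scope classical_set_scope.

Lemma increments_nondecreasing (R : realType) (u : nat -> R) :
  convex_seq u ->
  {homo (fun n => u n.+1 - u n) : m n / (m <= n)%N >-> m <= n}.
Proof.
move=> cvx_u; apply: homo_leq => [//||n]; first exact: le_trans.
by have /= := cvx_u n.+1 isT; lra.
Qed.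

(** The induction shrinks the interval from both ends, so the left end [m] must
    vary while the midpoint stays fixed. *)
Lemma convex_seq_midpoint (R : realType) (u : nat -> R) (m k : nat) :
  convex_seq u -> 2 * u (m + k)%N <= u m + u (m + k.*2)%N.
Proof.
move=> cvx_u; elim: k m => [|k IHk] m; first by rewrite !addn0; lra.
have := IHk m.+1; rewrite doubleS !addnS !addSn => mid.
have le_ends : (m <= (m + k.*2).+1)%N by lia.
by have /= := increments_nondecreasing cvx_u le_ends; lra.
Qed.

(* The natural-number quotient is exact, as n1 + n2 is even. *)
Theorem proposition1p2 (R : realType) (u : nat -> R) :
  convex_seq u <->
  (forall n1 n2 : nat, n1 = n2 %[mod 2] ->
     epi u (((n1 + n2) %/ 2)%N, (u n1 + u n2) / 2)).
Proof.
rewrite /epi /=; split=> [cvx_u n1 n2 eq_mod | mid [//|n] _].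
- wlog le_n : n1 n2 eq_mod / (n1 <= n2)%N => [IH|].
    case/orP: (leq_total n1 n2) => le_n; first exact: IH.
    by rewrite addnC [u n1 + _]addrC; apply: IH.
  have [k def_n2] : exists k, n2 = (n1 + k.*2)%N.
    by exists ((n2 - n1) %/ 2)%N; lia.
  have -> : ((n1 + n2) %/ 2 = n1 + k)%N by lia.
  by have := convex_seq_midpoint n1 k cvx_u; rewrite -def_n2; lra.
- have eq_mod : n = n.+2 %[mod 2] by lia.
  have := mid _ _ eq_mod.
  have -> : ((n + n.+2) %/ 2 = n.+1)%N by lia.
  by rewrite /=; lra.
Qed.
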